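(* Let $G=(V,E)$ be a finite simple graph and let $c$ be an integer greater than or equal to the chromatic number of $G$. Let $\Omega_c(G)$ be the (nonempty, finite) set of all proper vertex colorings $f:V\to\{1,2,\dots,c\}$ of $G$ (i.e. $f(x)\neq f(y)$ whenever $(x,y)\in E$), and let ${\rm E}$ denote expectation with respect to the uniform probability measure on $\Omega_c(G)$ (each coloring has probability $1/|\Omega_c(G)|$). Then for every vertex $x\in V$, $$ {\rm E}[i_f(x)] = K(x), $$ where $i_f(x)$ is the index of $f$ at $x$ and $K(x)$ is the curvature at $x$, as defined in the context.
   Context: For a finite simple graph $H$, let $v_k(H)$ denote the number of complete subgraphs $K_{k+1}$ of $H$ (so $v_0$ is the number of vertices, $v_1$ the number of edges, etc.), and define the Euler characteristic $\chi(H)=\sum_{k\ge 0}(-1)^k v_k(H)$; the empty graph has $\chi=0$. For a vertex $x\in V$ of $G=(V,E)$, the unit sphere $S(x)$ is the subgraph of $G$ induced by the vertex set $\{y\in V : (x,y)\in E\}$. For a function $f:V\to\{1,\dots,c\}$, $S^-_f(x)$ is the subgraph of $G$ induced by $\{y\in V: (x,y)\in E,\ f(y)<f(x)\}$, and the index is $i_f(x)=1-\chi(S^-_f(x))$. Let $V_k(x)$ be the number of $K_{k+1}$ subgraphs of $S(x)$ for $k\ge 0$, and set $V_{-1}(x)=1$. The curvature is $$K(x)=\sum_{k=0}^{\infty}(-1)^k\frac{V_{k-1}(x)}{k+1}$$ (a finite sum since $V_k(x)=0$ for large $k$). *)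

(* Defs.v *)
From HB Require Import structures.
From mathcomp Require Import all_boot all_order all_algebra.

Set Implicit Arguments.
Unset Strict Implicit.
Unset Printing Implicit Defensive.

Import Order.TTheory GRing.Theory Num.Theory.

Record sgraph := SGraph {
  vertex :> finType;
  adj : rel vertex;
  adj_sym : symmetric adj;
  adj_irrefl : irreflexive adj }.

Section Induced.
Variables (G : sgraph) (W : {set G}).

Definition induced_adj : rel {y : G | y \in W} :=
  fun y z => adj (val y) (val z).

Lemma induced_adj_sym : symmetric induced_adj.
Proof. by move=> y z; exact: adj_sym. Qed.

Lemma induced_adj_irrefl : irreflexive induced_adj.
Proof. by move=> y; exact: adj_irrefl. Qed.

Definition induced : sgraph := SGraph induced_adj_sym induced_adj_irrefl.
End Induced.

(* A complete subgraph is determined by its vertex set, so complete subgraphs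
   are represented by cliques. *)
Definition clique (H : sgraph) (A : {set H}) : bool :=
  [forall y in A, forall z in A, (y != z) ==> adj y z].

(* v_k(H): the number of subgraphs K_(k+1), which have k+1 vertices. *)
Definition nclique (H : sgraph) (k : nat) : nat :=
  #|[set A : {set H} | clique A & #|A| == k.+1]|.

(* This justifies truncating the sums over all k in [euler_char] and
   [curvature]. *)
Lemma nclique_eq0 (H : sgraph) (k : nat) : #|H| <= k -> nclique H k = 0.
Proof.
move=> leHk; apply/eqP; rewrite cards_eq0; apply/eqP/setP=> A.
rewrite !inE; apply/negbTE/negP=> /andP[_ /eqP cardA].
by have := max_card (mem A); rewrite cardA leqNgt ltnS leHk.
Qed.

Definition euler_char (H : sgraph) : int :=
  (\sum_(k < #|H|) (-1) ^+ k * (nclique H k)%:Z)%R.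

Definition unit_sphere (G : sgraph) (x : G) : sgraph :=
  induced [set y | adj x y].

(* The c colors 1, ..., c are represented by the elements 0, ..., c-1 of 'I_c
   in the same order. *)
Definition proper_coloring (G : sgraph) (c : nat) (f : {ffun G -> 'I_c}) :
    bool :=
  [forall x, forall y, adj x y ==> (f x != f y)].

Definition colorings (G : sgraph) (c : nat) : {set {ffun G -> 'I_c}} :=
  [set f | proper_coloring f].

Definition colorable (G : sgraph) (c : nat) : bool :=
  [exists f : {ffun G -> 'I_c}, proper_coloring f].

Lemma ex_colorable (G : sgraph) : exists c, colorable G c.
Proof.
exists #|G|; apply/existsP; exists [ffun x => enum_rank x].
apply/forallP=> x; apply/forallP=> y; apply/implyP=> xy.
rewrite !ffunE; apply: contraTneq xy => /enum_rank_inj ->.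
by rewrite adj_irrefl.
Qed.

Definition chromatic_number (G : sgraph) : nat := ex_minn (ex_colorable G).

Definition lower_sphere (G : sgraph) (c : nat) (f : {ffun G -> 'I_c}) (x : G) :
    sgraph :=
  induced [set y | adj x y & f y < f x].

Definition coloring_index (G : sgraph) (c : nat) (f : {ffun G -> 'I_c}) (x : G) : int :=
  (1 - euler_char (lower_sphere f x))%R.

(* [sphere_count x k] is V_(k-1)(x): the index is shifted by one so that the
   convention V_(-1)(x) = 1 is the value at k = 0. *)
Definition sphere_count (G : sgraph) (x : G) (k : nat) : nat :=
  if k is j.+1 then nclique (unit_sphere x) j else 1.

Definition curvature (G : sgraph) (x : G) : rat :=
  (\sum_(k < #|unit_sphere x|.+1)
     (-1) ^+ k * ((sphere_count x k)%:R / k.+1%:R))%R.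

(* Expectation for the uniform probability measure on A (A nonempty). *)
Definition uniform_expectation (T : finType) (A : {set T}) (X : T -> rat) :
    rat :=
  (\sum_(a in A) #|A|%:R^-1 * X a)%R.

(* Main.v *)
(* Summing over the cliques A of the unit sphere of x, the index is
   the sum of (-1)^|A| over those A on which f stays below f x, and the
   curvature is the sum of (-1)^|A| / (|A| + 1).  It thus suffices that f x is
   the largest color on the clique B = x |: A with probability 1 / |B|: the
   largest color is attained exactly once on B, and exchanging the colors f x
   and f z throughout G is a bijection between the colorings with maximum at x
   and those with maximum at z. *)
Require Import Defs.
From mathcomp Require Import all_boot all_order all_algebra.
From mathcomp Require Import fingroup perm.

Set Implicit Arguments.
Unset Strict Implicit.
Unset Printing Implicit Defensive.

Import Order.TTheory GRing.Theory Num.Theory.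

Local Open Scope ring_scope.

Lemma cliqueP (H : sgraph) (A : {set H}) :
  reflect {in A &, forall y z, y != z -> adj y z} (clique A).
Proof.
apply: (iffP forall_inP) => [cA y z yA zA|cA y yA].
  by move/forall_inP: (cA y yA) => /(_ z zA) /implyP.
by apply/forall_inP => z zA; apply/implyP; apply: cA.
Qed.

Lemma clique0 (H : sgraph) : clique (set0 : {set H}).
Proof. by apply/cliqueP => y z; rewrite inE. Qed.

Lemma clique_setU1 (G : sgraph) (x : G) (A : {set G}) :
  A \subset [set y | adj x y] -> clique A -> clique (x |: A).
Proof.
move=> /subsetP sA /cliqueP cA; apply/cliqueP => y z.
have xA w : w \in A -> adj x w by move/sA; rewrite inE.
rewrite !inE => /predU1P[->|yA] /predU1P[->|zA].
- by rewrite eqxx.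
- by move=> _; apply: xA.
- by move=> _; rewrite adj_sym; apply: xA.
- exact: cA.
Qed.

Lemma clique_induced (G : sgraph) (W : {set G}) (A : {set induced W}) :
  clique (val @: A) = clique A.
Proof.
apply/cliqueP/cliqueP => cA.
  by move=> y z yA zA nyz; apply: cA; rewrite ?imset_f// (inj_eq val_inj).
move=> _ _ /imsetP[y yA ->] /imsetP[z zA ->] nyz.
by apply: cA; rewrite // -(inj_eq val_inj).
Qed.

(** Taking images under [val] moves cliques out of the sigma type, so that lower spheres of
    different colorings all live in [{set G}] and can be compared. *)
Lemma nclique_induced (G : sgraph) (W : {set G}) (k : nat) :
  nclique (induced W) k =
  #|[set A : {set G} | [&& A \subset W, clique A & #|A| == k.+1]]|.
Proof.
rewrite /nclique -(card_imset _ (imset_inj val_inj)).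
apply: eq_card => A; rewrite [in RHS]inE.
apply/imsetP/and3P => [[B + ->]|[sAW cA kA]].
  rewrite inE => /andP[cB kB]; split; last by rewrite (card_imset _ val_inj).
    by apply/subsetP => _ /imsetP[y _ ->]; apply: valP.
  by rewrite clique_induced.
have AE : A = val @: [set y : induced W | val y \in A].
  apply/setP => y; apply/idP/imsetP => [yA|[z + ->]]; last by rewrite inE.
  by exists (Sub y (subsetP sAW y yA)); rewrite ?inE SubK.
exists [set y : induced W | val y \in A] => //.
by rewrite inE -clique_induced -(card_imset _ val_inj) -AE cA kA.
Qed.

(** Grouping by cardinality; the isolated [F 0] comes from the empty clique, which accounts both for
    the 1 in the index and for the convention V_(-1)(x) = 1. *)
Lemma sum_cliques (R : pzRingType) (G : sgraph) (W : {set G}) (F : nat -> R) :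
  \sum_(A : {set G} | (A \subset W) && clique A) F #|A| =
  F 0 + \sum_(k < #|induced W|) F k.+1 * (nclique (induced W) k)%:R.
Proof.
have cW : #|induced W| = #|W| by rewrite card_sig.
(* [inord] loses nothing here: a subset of [W] has at most [#|W|] elements. *)
rewrite (partition_big (fun A : {set G} => inord #|A| : 'I_#|W|.+1) xpredT)//=.
have cardE (A : {set G}) (k : 'I_#|W|.+1) : A \subset W ->
    (inord #|A| == k) = (#|A| == k :> nat).
  by move=> sAW; rewrite -val_eqE /= inordK // ltnS subset_leq_card.
rewrite big_ord_recl cW; congr (_ + _).
  rewrite (big_pred1 set0) ?cards0// => A.
  case: (boolP (A \subset W)) => sAW; last first.
    by apply/esym/negbTE; apply: contraNneq sAW => ->; rewrite sub0set.
  rewrite cardE//= cards_eq0 andb_idl// => /eqP->; exact: clique0.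
apply: eq_bigr => k _; rewrite nclique_induced mulr_natr -sumr_const.
apply: eq_big => [A|A /andP[/andP[sAW _]]]; last by rewrite cardE// => /eqP->.
rewrite inE; case: (boolP (A \subset W)) => //= sAW.
by rewrite cardE.
Qed.

Lemma coloring_indexE (G : sgraph) (c : nat) (f : {ffun G -> 'I_c}) (x : G) :
  coloring_index f x =
  \sum_(A : {set G} | (A \subset [set y | adj x y & (f y < f x)%N]) && clique A)
    (-1) ^+ #|A|.
Proof.
rewrite (sum_cliques _ (fun n => (-1) ^+ n)) expr0 /coloring_index /euler_char.
congr (_ + _); rewrite -sumrN; apply: eq_bigr => k _.
by rewrite exprS mulN1r mulNr natz.
Qed.

Lemma curvatureE (G : sgraph) (x : G) :
  curvature x =
  \sum_(A : {set G} | (A \subset [set y | adj x y]) && clique A)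
    (-1) ^+ #|A| / #|A|.+1%:R.
Proof.
rewrite (sum_cliques _ (fun n => (-1) ^+ n / n.+1%:R)) /curvature big_ord_recl.
congr (_ + _); apply: eq_bigr => k _.
by rewrite /= mulrAC mulrA.
Qed.

Lemma colorings_gt0 (G : sgraph) (c : nat) :
  (chromatic_number G <= c)%N -> (0 < #|colorings G c|)%N.
Proof.
rewrite /chromatic_number; case: ex_minnP => m /existsP[f /forallP pf] _ le_mc.
apply/card_gt0P; exists [ffun y => widen_ord le_mc (f y)]; rewrite inE.
apply/forallP => y; apply/forallP => z; apply/implyP => yz; rewrite !ffunE.
by move/forallP: (pf y) => /(_ z) /implyP /(_ yz).
Qed.

Section MaxColor.
Variables (G : sgraph) (c : nat).
Implicit Types (f : {ffun G -> 'I_c}) (B : {set G}) (x z : G).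

Definition max_colorings B x : {set {ffun G -> 'I_c}} :=
  [set f in colorings G c | [forall y in B, (f y <= f x)%N]].

Definition swap_colors x z f : {ffun G -> 'I_c} :=
  [ffun y => tperm (f x) (f z) (f y)].

(** The transposition depends on [f], but after the swap [x] and [z] carry the same two colors in
    the opposite order, so the second transposition is the same one. *)
Lemma swap_colorsK x z : involutive (swap_colors x z).
Proof.
move=> f; apply/ffunP => y.
by rewrite !ffunE tpermL tpermR tpermC tpermK.
Qed.

Lemma clique_inj_coloring B f : clique B -> f \in colorings G c ->
  {in B &, injective f}.
Proof.
move=> /cliqueP cB; rewrite inE => /forallP pf y z yB zB fyz.
apply: contra_eq fyz => nyz.
by move/forallP: (pf y) => /(_ z) /implyP; apply; apply: cB.
Qed.

Lemma swap_colors_max B x z f : x \in B -> z \in B ->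
  f \in max_colorings B x -> swap_colors x z f \in max_colorings B z.
Proof.
move=> xB zB; rewrite inE => /andP[Cf /forall_inP mx].
rewrite !inE; apply/andP; split.
  move: Cf; rewrite inE => /forallP pf.
  apply/forallP => y; apply/forallP => w; apply/implyP => yw; rewrite !ffunE.
  by rewrite (inj_eq perm_inj); move/forallP: (pf y) => /(_ w) /implyP; apply.
apply/forall_inP => y yB; rewrite !ffunE tpermR.
(* The new color of [z] is [f x]; each new color on [B] is an old color of some vertex of [B], hence
   at most [f x]. *)
by case: tpermP => // *; apply: mx.
Qed.

Lemma card_max_colorings_sym B x z : x \in B -> z \in B ->
  #|max_colorings B x| = #|max_colorings B z|.
Proof.
suff le u v : u \in B -> v \in B ->
    (#|max_colorings B u| <= #|max_colorings B v|)%N.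
  by move=> xB zB; apply/eqP; rewrite eqn_leq !le.
move=> uB vB; rewrite -(card_imset _ (inv_inj (swap_colorsK u v))).
apply/subset_leq_card/subsetP => _ /imsetP[f fu ->].
exact: swap_colors_max.
Qed.

Lemma card_max_colorings B x : clique B -> x \in B ->
  (#|B| * #|max_colorings B x|)%N = #|colorings G c|.
Proof.
(* The colorings are partitioned by the vertex of [B] with the largest color; by symmetry all [#|B|]
   classes have equal size. *)
move=> cB xB; pose top f := [arg max_(y > x in B) f y]%N.
rewrite -sum_nat_const -[RHS]sum1_card (partition_big top (mem B)) /=; last first.
  by move=> f _; rewrite /top; case: arg_maxnP.
apply: eq_bigr => z zB; rewrite (card_max_colorings_sym xB zB) -sum1_card.
apply: eq_bigl => f; rewrite inE; case: (boolP (f \in _)) => //= Cf.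
rewrite /top; case: arg_maxnP => // w wB mw.
apply/forall_inP/eqP => [mz|<-] //.
(* Two maximizers share a color, and a proper coloring is injective on a clique. *)
apply: (clique_inj_coloring cB Cf) => //; apply/val_inj/eqP.
by rewrite eqn_leq mz //=; apply: mw.
Qed.

(** Vertices of [A] are adjacent to [x], so properness makes the weak inequality of [max_colorings]
    strict. *)
Lemma max_coloringsU1 (A : {set G}) x f : A \subset [set y | adj x y] ->
  (f \in max_colorings (x |: A) x) =
  (f \in colorings G c) && (A \subset [set y | adj x y & (f y < f x)%N]).
Proof.
move=> /subsetP sA; rewrite [LHS]inE; case: (boolP (f \in _)) => //= Cf.
apply/forall_inP/subsetP => [mx y yA|lt y].
  move: (sA y yA); rewrite !inE => xy; rewrite xy /= ltn_neqAle.
  rewrite mx ?inE ?yA ?orbT// andbT eq_sym.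
  by move: Cf; rewrite inE => /forallP /(_ x) /forallP /(_ y) /implyP; apply.
by case/setU1P => [->//|/lt]; rewrite inE => /andP[_ /ltnW].
Qed.

End MaxColor.

Lemma sum_coloring_index (G : sgraph) (c : nat) (x : G) :
  \sum_(f in colorings G c) (coloring_index f x)%:~R =
  #|colorings G c|%:R * curvature x.
Proof.
pose below (f : {ffun G -> 'I_c}) := [set y | adj x y & (f y < f x)%N].
have indexE f : (coloring_index f x)%:~R =
    \sum_(A : {set G} | (A \subset below f) && clique A) (-1) ^+ #|A| :> rat.
  rewrite coloring_indexE rmorph_sum.
  by apply: eq_bigr => A _; rewrite rmorphXn rmorphN1.
under eq_bigr do rewrite indexE.
(* Every clique below [f x] lies in the full unit sphere, which gives an outer range independent of
   [f]. *)
rewrite (exchange_big_dep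
  (fun A : {set G} => (A \subset [set y | adj x y]) && clique A)) /=; last first.
  move=> f A _ /andP[sA ->]; rewrite andbT (subset_trans sA)//.
  by apply/subsetP => y; rewrite !inE => /andP[].
rewrite curvatureE mulr_sumr; apply: eq_bigr => A /andP[sA cA].
have xNA : x \notin A.
  by apply/negP => /(subsetP sA); rewrite inE adj_irrefl.
(* The factor [#|x |: A|], equal to [#|A|.+1], will cancel the denominator in the curvature. *)
rewrite -(card_max_colorings c (clique_setU1 sA cA) (setU11 x A)).
rewrite cardsU1 xNA add1n.
transitivity ((-1) ^+ #|A| *+ #|max_colorings c (x |: A) x| : rat).
  rewrite -sumr_const; apply: eq_bigl => f.
  by rewrite max_coloringsU1// cA andbT.
by rewrite natrM -mulr_natr [RHS]mulrC mulrA divfK ?pnatr_eq0.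
Qed.

Local Close Scope ring_scope.

Theorem theorem1 (G : sgraph) (c : nat) (hc : chromatic_number G <= c) (x : G) :
  uniform_expectation (colorings G c) (fun f => (coloring_index f x)%:~R%R) =
  curvature x.
Proof.
rewrite /uniform_expectation -mulr_sumr sum_coloring_index mulKf//.
(* Dividing by the number of colorings is legitimate because [hc] provides at least one. *)
by rewrite pnatr_eq0 -lt0n colorings_gt0.
Qed.
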